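(* Let $(P,\lambda)$ be a rank-uniform labeled poset of rank $n$. For all $1\le k\le n-1$, the truncation $\mathrm{Tr}^k(P)$ admits an EL-labeling $\lambda^k$ such that $(\mathrm{Tr}^k(P),\lambda^k)$ is a rank-uniform labeled poset. Furthermore, if $(P,\lambda)$ is monotonic, then so is $(\mathrm{Tr}^k(P),\lambda^k)$.
   Context: All posets are finite, bounded (minimum $\hat 0$, maximum $\hat 1$) and graded with rank function $\mathrm{rk}$, $\mathrm{rk}(\hat 0)=0$; the rank of $P$ is $\mathrm{rk}(\hat 1)$. Write $s\lessdot t$ if $t$ covers $s$, and $\mathcal E(P)$ for the set of covering pairs. For $P$ of rank $n$, $\mathrm{Tr}^k(P)$ is the induced subposet of elements of rank in $\{0,1,\dots,n-k-1\}\cup\{n\}$. An edge labeling is a map $\lambda:\mathcal E(P)\to\Lambda$ to a totally ordered set $(\Lambda,\vartriangleleft)$. It is an EL-labeling if for all $s\le t$ there is a unique maximal chain $s=u_0\lessdot\cdots\lessdot u_k=t$ of $[s,t]$ with weakly increasing labels $\lambda(u_0,u_1)\trianglelefteq\cdots\trianglelefteq\lambda(u_{k-1},u_k)$, and its label sequence is lexicographically minimal among all maximal chains of $[s,t]$. An EL-labeled poset is a pair $(P,\lambda)$ with $\lambda$ an EL-labeling of $P$. For $s\in P$ let $\lambda_1\vartriangleleft\cdots\vartriangleleft\lambda_\ell$ be the distinct labels $\lambda(s,t)$, $t\gtrdot s$ (the labels above $s$). The width is $\omega_s(i)=|\{t: s\lessdot t,\ \lambda(s,t)=\lambda_i\}|$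 (equal to $0$ for $i>\ell$). For $s\lessdot t$, $\mathrm{Ind}(s,t)$ is the $i$ with $\lambda(s,t)=\lambda_i$, and $\mathrm{des}_s(t)$ is the number of distinct labels above $t$ that are $\vartriangleleft\lambda(s,t)$. An EL-labeled poset $(P,\lambda)$ is a rank-uniform labeled poset if (1) $\omega_s(i)=\omega_{s'}(i)$ for all $s,s'$ of the same rank and all $i\ge1$; and (2) $\mathrm{des}_s(t)=\mathrm{des}_{s'}(t')$ whenever $s\lessdot t$, $s'\lessdot t'$, $\mathrm{rk}(s)=\mathrm{rk}(s')$ and $\mathrm{Ind}(s,t)=\mathrm{Ind}(s',t')$. In that case $\mathrm{des}_k(i)$ denotes $\mathrm{des}_s(t)$ for any $s$ of rank $k$ and $t\gtrdot s$ with $\mathrm{Ind}(s,t)=i$, and $\ell_k$ is the number of distinct labels above any element of rank $k$. It is monotonic if for every $0\le k\le \mathrm{rk}(P)-1$ the function $i\mapsto\mathrm{des}_k(i)$ is weakly increasing on $\{1,\dots,\ell_k\}$. *)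

(* Defs.v *)
From HB Require Import structures.
From mathcomp Require Import all_boot all_order.

Set Implicit Arguments.
Unset Strict Implicit.
Unset Printing Implicit Defensive.

Import Order.TTheory.

Definition covers {d : Order.disp_t} {T : finPOrderType d} : rel T :=
  fun s t => (s < t)%O && ~~ [exists u, (s < u < t)%O].

(* The axioms determine rk uniquely, so grading is a property of the poset. *)
HB.mixin Record isGraded d T of Order.FinTBPOrder d T := {
  rk : T -> nat;
  rk_bot : rk \bot%O = 0;
  rk_covers : forall s t : T, covers s t -> rk t = (rk s).+1
}.

#[short(type="gradedPosetType")]
HB.structure Definition GradedPoset (d : Order.disp_t) :=
  { T of isGraded d T & Order.FinTBPOrder d T }.

Definition rank (d : Order.disp_t) (P : gradedPosetType d) : nat :=
  rk (\top%O : P).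

Section GradedTheory.

Context {d : Order.disp_t} {P : gradedPosetType d}.
Implicit Types s t u : P.

Lemma covers_lt s t : covers s t -> (s < t)%O.
Proof. by case/andP. Qed.

Lemma covers_below s t : (s < t)%O -> exists2 u, covers s u & (u <= t)%O.
Proof.
have [m] := ubnP #|[pred u | (s < u < t)%O]|.
elim: m t => // m IHm t le_m lt_st.
case: (boolP [exists u, (s < u < t)%O]) => [/existsP[u /andP[lt_su lt_ut]]|nex].
  have [|//|v cov_sv le_vu] := IHm u; last first.
    by exists v => //; exact: le_trans le_vu (ltW lt_ut).
  move: le_m; rewrite ltnS; apply: leq_trans.
  apply: proper_card; apply/properP; split; first by apply/subsetP => v /andP[sv vu]; apply/andP; split=> //;
    exact: lt_trans vu lt_ut.
  by exists u; rewrite !inE ?lt_su ?lt_ut // ltxx.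
by exists t => //; rewrite /covers lt_st nex.
Qed.

Lemma rk_mono s t : (s < t)%O -> rk s < rk t.
Proof.
have [m] := ubnP #|[pred u | (s < u)%O]|.
elim: m s => // m IHm s le_m lt_st.
have [u cov_su le_ut] := covers_below lt_st; have lt_su := covers_lt cov_su.
have rk_su := rk_covers _ _ cov_su.
move: le_ut; rewrite le_eqVlt => /orP[/eqP <-|lt_ut]; first by rewrite rk_su.
suff lt_rk : rk u < rk t by apply: leq_trans lt_rk; rewrite rk_su ltnW.
apply: IHm => //; move: le_m; rewrite ltnS; apply: leq_trans.
apply: proper_card; apply/properP; split; first by apply/subsetP => v; exact: lt_trans lt_su.
by exists u; rewrite !inE ?lt_su // ltxx.
Qed.

End GradedTheory.

(* Subtraction on nat is truncated, so that \bot is kept for every k and the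
   type is a bounded poset unconditionally; the value is meaningful for
   k < rank P. *)
Definition in_trunc (d : Order.disp_t) (P : gradedPosetType d) (k : nat) :
  pred P := fun x => (rk x <= rank P - k - 1) || (rk x == rank P).

Definition trunc (d : Order.disp_t) (P : gradedPosetType d) (k : nat) : Type :=
  {x : P | in_trunc k x}.

Section Truncation.

Context {d : Order.disp_t} (P : gradedPosetType d) (k : nat).
Local Notation Tr := (trunc P k).

HB.instance Definition _ := SubFinite.on Tr.
HB.instance Definition _ := [SubChoice_isSubPOrder of Tr by <: with d].

Fact in_trunc_bot : in_trunc k (\bot%O : P).
Proof. by rewrite /in_trunc rk_bot. Qed.

Fact in_trunc_top : in_trunc k (\top%O : P).
Proof. by rewrite /in_trunc eqxx orbT. Qed.

Definition trunc_bot : Tr := Sub (\bot%O : P) in_trunc_bot.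
Definition trunc_top : Tr := Sub (\top%O : P) in_trunc_top.

Fact trunc_le0x (x : Tr) : (trunc_bot <= x)%O.
Proof. by rewrite leEsub SubK le0x. Qed.

Fact trunc_lex1 (x : Tr) : (x <= trunc_top)%O.
Proof. by rewrite leEsub SubK lex1. Qed.

HB.instance Definition _ := Order.hasBottom.Build d Tr trunc_le0x.
HB.instance Definition _ := Order.hasTop.Build d Tr trunc_lex1.

(* rk on the ranks 0 .. n-k-1, and n - k at the top *)
Definition trunc_rk (x : Tr) : nat := minn (rk (val x)) (rank P - k - 1).+1.

Fact trunc_rk_bot : trunc_rk \bot%O = 0.
Proof. by rewrite /trunc_rk /= rk_bot min0n. Qed.

Fact trunc_rk_covers (s t : Tr) : covers s t -> trunc_rk t = (trunc_rk s).+1.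
Proof.
rewrite /trunc_rk => /andP[lt_st nex].
have lt_st' : (val s < val t)%O by rewrite -ltEsub.
have lt_rk := rk_mono lt_st'.
have le_t : rk (val t) <= rank P.
  have := lex1 (val t); rewrite le_eqVlt => /orP[/eqP ->|/rk_mono/ltnW] //.
have lt_mn : rank P - k - 1 < rank P.
  rewrite -subnDA ltn_subrL addn1 /=.
  exact: leq_ltn_trans (leq0n _) (leq_trans lt_rk le_t).
have le_s : rk (val s) <= rank P - k - 1.
  have := valP s; rewrite /in_trunc => /orP[//|/eqP s_top].
  by move: (leq_trans lt_rk le_t); rewrite s_top ltnn.
have [u cov_su le_ut] := covers_below lt_st'.
have lt_su := covers_lt cov_su; have rk_su := rk_covers _ _ cov_su.
have [u_tr|u_tr] := boolP (in_trunc k u).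
  have eq_ut : u = val t.
    apply/eqP; move: le_ut; rewrite le_eqVlt => /orP[//|lt_ut].
    case/negP: nex; apply/existsP; exists (Sub u u_tr : Tr).
    by rewrite !ltEsub !SubK lt_su.
  rewrite -eq_ut rk_su (minn_idPl _) ?ltnS //.
  by rewrite (minn_idPl _) // leqW.
have gt_u : rank P - k - 1 < rk u.
  by move: u_tr; rewrite /in_trunc negb_or -ltnNge => /andP[].
have gt_t : rank P - k - 1 < rk (val t).
  apply: leq_trans gt_u _; move: le_ut.
  by rewrite le_eqVlt => /orP[/eqP ->|/rk_mono/ltnW].
rewrite (minn_idPr gt_t) (minn_idPl (leqW le_s)); congr _.+1.
by apply/eqP; rewrite eqn_leq le_s andbT -ltnS -rk_su.
Qed.

HB.instance Definition _ :=
  isGraded.Build d Tr trunc_rk_bot trunc_rk_covers.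

End Truncation.

(* Only the values at covering pairs matter: every notion below reads
   [lam s t] for [covers s t] only. *)
Definition edge_labeling (d dL : Order.disp_t) (P : gradedPosetType d)
  (L : orderType dL) : Type := P -> P -> L.

Section Labelings.

Context {d dL : Order.disp_t} {P : gradedPosetType d} {L : orderType dL}.
Variable lam : edge_labeling P L.
Implicit Types (s t : P) (p q : seq P).

(* The chain s = u_0 <. u_1 <. ... <. u_k = t is given by p = [u_1; ...; u_k]. *)
Definition maximal_chain s t p : Prop := path covers s p /\ last s p = t.

Definition label_seq s p : seqlexi L := pairmap lam s p.

Definition increasing_chain s t p : Prop :=
  maximal_chain s t p /\ sorted <=%O (label_seq s p : seq L).

(* Weak minimality suffices: two maximal chains of [s, t] with the label
   sequence of the increasing one are both increasing, hence equal. *)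
Definition EL_labeling : Prop :=
  forall s t, (s <= t)%O ->
    exists p, unique (increasing_chain s t) p /\
      forall q, maximal_chain s t q -> (label_seq s p <= label_seq s q)%O.

Definition labels_above s : seq L :=
  sort <=%O (undup [seq lam s t | t in covers s]).

(* Indices i start at 1, as in lambda_1 < ... < lambda_l. *)
Definition width s (i : nat) : nat :=
  #|[set t | covers s t & onth (labels_above s) i.-1 == Some (lam s t)]|.

Definition Ind s t : nat := (index (lam s t) (labels_above s)).+1.

Definition des s t : nat := count (< lam s t)%O (labels_above t).

Definition rank_uniform : Prop :=
  [/\ EL_labeling,
      forall s s' (i : nat), rk s = rk s' -> 1 <= i -> width s i = width s' i
    & forall s t s' t', covers s t -> covers s' t' -> rk s = rk s' ->
        Ind s t = Ind s' t' -> des s t = des s' t'].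

(* des_k(i) and l_k, computed at an arbitrary choice of s (and t) of rank k;
   see desr_eq and nlabelsr_eq for the independence of the choice. *)
Definition desr (k i : nat) : nat :=
  if [pick e : P * P | [&& covers e.1 e.2, rk e.1 == k & Ind e.1 e.2 == i]]
    is Some e then des e.1 e.2 else 0.

Definition nlabelsr (k : nat) : nat :=
  if [pick s : P | rk s == k] is Some s then size (labels_above s) else 0.

Definition monotonic : Prop :=
  forall k i j : nat, k < rank P ->
    1 <= i -> i <= j -> j <= nlabelsr k -> desr k i <= desr k j.

Lemma desr_eq s t : rank_uniform -> covers s t ->
  desr (rk s) (Ind s t) = des s t.
Proof.
move=> [_ _ des_eq] cov_st; rewrite /desr.
case: pickP => [[s' t'] /= /and3P[cov' /eqP rk' /eqP Ind']|/(_ (s, t))] /=.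
  exact: des_eq.
by rewrite cov_st !eqxx.
Qed.

Lemma width_gt0 s (i : nat) : 1 <= i ->
  (0 < width s i) = (i <= size (labels_above s)).
Proof.
case: i => // i _; rewrite -onthTE.
apply/card_gt0P/idP => [[t]|]; first by rewrite inE => /andP[_ /eqP ->].
case def_a: (onth _ _) => [a|//] _.
have: a \in labels_above s by apply/onthP; exists i.
rewrite mem_sort mem_undup => /imageP[t cov_st def_at].
by exists t; rewrite inE def_at eqxx andbT.
Qed.

Lemma nlabelsr_eq s : rank_uniform -> nlabelsr (rk s) = size (labels_above s).
Proof.
move=> [_ width_eq _]; rewrite /nlabelsr; case: pickP => [s' /eqP rk'|/(_ s)].
  have le_size u v : rk u = rk v ->
      size (labels_above u) <= size (labels_above v).
    case Eu: (size _) => [//|m] rk_uv; rewrite -width_gt0 //.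
    by rewrite -(width_eq u v) // width_gt0 // Eu.
  by apply/eqP; rewrite eqn_leq !le_size.
by rewrite eqxx.
Qed.

End Labelings.

(* Main.v *)
Require Import Defs.
From mathcomp Require Import all_boot all_order.

Set Implicit Arguments.
Unset Strict Implicit.
Unset Printing Implicit Defensive.

Import Order.Theory.

(** Let [m = rank P - k - 1] be the largest rank kept below [\top].  The only
    covering pairs of the truncation that do not come from [P] are the pairs
    [(s, \top)] with [rk s = m]; label such a pair by the smallest label above
    [s] in [P], and keep all other labels ([trunc_labeling]).

    Why this is an EL-labeling: in [P] the increasing chain from [s] to [\top]
    starts with the smallest label above [s] ([increasing_chain_head]).  Hence a
    maximal chain of the truncation going through [s] to [\top] can be completed
    by that increasing chain to a maximal chain of [P], whose label sequence
    has the given one as a prefix and is increasing exactly when the given one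
    is ([trunc_chain_extension]).  So increasing chains to [\top] in the
    truncation are the increasing chains of [P] cut at rank [m], which gives
    existence and uniqueness, and lexicographic minimality passes to prefixes
    of equal length.  Intervals with top below [\top] are intervals of [P].

    Why rank-uniformity and monotonicity survive: below rank [m] the labels
    above an element are unchanged, and at rank [m] there is a single label.
    Hence the widths are uniform, and [des] is unchanged except for edges
    into rank [m], where it becomes [minn 1 des]: only the smallest of the
    labels above the upper end is left, and it lies below a given label iff
    some label does.  Since [minn 1] is weakly increasing, monotonicity is
    preserved. *)

(** * Sequences and lexicographic order *)

Lemma lexi_prefix (dL : Order.disp_t) (L : orderType dL) (a b a' b' : seq L) :
  size a = size b ->
  (a ++ a' <= b ++ b' :> seqlexi L)%O -> (a <= b :> seqlexi L)%O.
Proof.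
elim: a b => [|x a IHa] [|y b] //= [eq_sz].
rewrite !lexi_cons => /andP[-> /implyP le_ab] /=.
by apply/implyP => /le_ab; exact: IHa.
Qed.

Lemma pairmap_rcons (T1 T2 : Type) (f : T1 -> T1 -> T2) x s y :
  pairmap f x (rcons s y) = rcons (pairmap f x s) (f (last x s) y).
Proof. by rewrite -cats1 pairmap_cat cats1. Qed.

Lemma count_lt_sorted (dL : Order.disp_t) (L : orderType dL) (x0 a : L) s :
  sorted <=%O s -> (0 < count (< a)%O s) = (s != [::]) && (head x0 s < a)%O.
Proof.
case: s => [//|x s] /= sorted_s; case: ltP => //= le_ax.
rewrite add0n -has_count; apply/negbTE/hasPn => y s_y.
move: sorted_s; rewrite (path_sortedE le_trans) => /andP[/allP le_xs _].
by rewrite -leNgt (le_trans le_ax) // le_xs.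
Qed.

(** * Ranks, chains and labels in a graded poset *)

Section Graded.

Context {d dL : Order.disp_t} {P : gradedPosetType d} {L : orderType dL}.
Variable lam : edge_labeling P L.
Implicit Types (s t u : P) (p q : seq P).

Lemma rk_rank s : (rk s == rank P) = (s == \top%O).
Proof.
apply/eqP/eqP => [rk_s|->//]; apply/eqP; have := lex1 s.
by rewrite le_eqVlt => /orP[//|/rk_mono]; rewrite -/(rank P) rk_s ltnn.
Qed.

Lemma rk_path s p : path covers s p -> rk (last s p) = rk s + size p.
Proof.
elim: p s => [|t p IHp] s /=; first by rewrite addn0.
by case/andP=> /rk_covers rk_t /IHp->; rewrite rk_t addSnnS.
Qed.

Lemma labels_aboveP s a :
  reflect (exists2 t, covers s t & a = lam s t) (a \in labels_above lam s).
Proof. by rewrite mem_sort mem_undup; apply: imageP. Qed.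

Lemma labels_above_sorted s : sorted <=%O (labels_above lam s).
Proof. exact: sort_le_sorted. Qed.

Lemma labels_above_uniq s : uniq (labels_above lam s).
Proof. by rewrite sort_uniq undup_uniq. Qed.

Lemma head_labels_above x0 s t : covers s t ->
  head x0 (labels_above lam s) \in labels_above lam s
  /\ (head x0 (labels_above lam s) <= lam s t)%O.
Proof.
move=> cov_st.
have: lam s t \in labels_above lam s by apply/labels_aboveP; exists t.
have := labels_above_sorted s; case: (labels_above lam s) => [//|a l] /=.
rewrite (path_sortedE le_trans) inE mem_head => /andP[/allP le_al _].
by case/predU1P => [->//|/le_al].
Qed.

Lemma Ind_surj s i :
  0 < i <= size (labels_above lam s) -> exists2 t, covers s t & Ind lam s t = i.
Proof.
case: i => //= i lt_i; case def_l: (labels_above lam s) => [|a l].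
  by rewrite def_l in lt_i.
have: nth a (labels_above lam s) i \in labels_above lam s by rewrite mem_nth.
case/labels_aboveP => t cov_t def_i; exists t => //.
by rewrite /Ind -def_i index_uniq ?labels_above_uniq.
Qed.

Lemma increasing_chain_catr s t p q :
  increasing_chain lam s t (p ++ q) -> increasing_chain lam (last s p) t q.
Proof.
case=> -[]; rewrite cat_path last_cat => /andP[_ path_q] last_q.
by rewrite /label_seq pairmap_cat => /cat_sorted2[_].
Qed.

(** Any edge out of [s] starts some maximal chain to [\top], so the first label
    of the lexicographically least one is the smallest label above [s]. *)
Lemma increasing_chain_head x0 s u p :
  EL_labeling lam -> increasing_chain lam s \top%O (u :: p) ->
  lam s u = head x0 (labels_above lam s).
Proof.
move=> EL inc_up; have [p0 [[_ uniq_p0] min_p0]] := EL _ _ (lex1 s).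
rewrite (uniq_p0 _ inc_up) {p0 uniq_p0} in min_p0.
case: inc_up => -[/= /andP[cov_su _] _ _].
have [/labels_aboveP[v cov_sv ->] le_su] := head_labels_above x0 cov_su.
apply/eqP; rewrite eq_le; apply/andP; split; last first.
  by case: (head_labels_above (lam s v) cov_su) => _ _; apply: le_su.
have [q [[[[path_q last_q] _] _] _]] := EL _ _ (lex1 v).
have := min_p0 (v :: q); rewrite /label_seq /= lexi_cons.
by case/(_ _)/andP => //; split; rewrite /= ?cov_sv.
Qed.

End Graded.

(** * Covering pairs and chains of the truncation *)

Section Truncation.

Context {d dL : Order.disp_t} {P : gradedPosetType d} {L : orderType dL}.
Variables (lam : edge_labeling P L) (k : nat).
Hypothesis rank_gt0 : 0 < rank P.
Local Notation Tr := (trunc P k).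
Local Notation m := (rank P - k - 1).
Implicit Types (s t : Tr) (p q : seq Tr).

Lemma ltn_trunc_rank : m < rank P.
Proof. by rewrite -subnDA ltn_subrL addn1 rank_gt0. Qed.

Lemma rk_val_le t : (rk (val t) <= m) = (t != \top%O).
Proof.
have := valP t; rewrite /in_trunc rk_rank -(inj_eq val_inj).
rewrite -[val (\top%O : Tr)]/(\top%O : P); case: eqP => [->|_].
  by rewrite leqNgt ltn_trunc_rank.
by rewrite orbF => ->.
Qed.

Lemma trunc_rkE s : s != \top%O -> rk s = rk (val s).
Proof.
by rewrite -rk_val_le => le_s; apply/minn_idPl/leqW.
Qed.

Lemma trunc_rank : rank Tr = m.+1.
Proof. exact/minn_idPr/ltn_trunc_rank. Qed.

Lemma covers_val s t : t != \top%O -> covers s t = covers (val s) (val t).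
Proof.
rewrite -rk_val_le => le_t; rewrite /covers -lt_val; congr (_ && ~~ _).
apply/existsP/existsP => [[u]|[u /andP[lt_su lt_ut]]].
  by rewrite -!lt_val; exists (val u).
have u_tr : in_trunc k u.
  by rewrite /in_trunc (leq_trans (ltnW (rk_mono lt_ut))).
by exists (Sub u u_tr : Tr); rewrite -!lt_val !SubK lt_su.
Qed.

Lemma covers_trunc_top s : covers s \top%O = (rk (val s) == m).
Proof.
apply/idP/eqP => [cov_s|rk_s].
  have s_ntop: s != \top%O by have := covers_lt cov_s; rewrite lt_neqAle => /andP[].
  have := rk_covers _ _ cov_s; rewrite -/(rank Tr) trunc_rank => -[->].
  by rewrite trunc_rkE.
have s_ntop : s != \top%O by rewrite -rk_val_le rk_s.
rewrite /covers lt_neqAle s_ntop lex1; apply/existsP => -[u /andP[lt_su]].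
rewrite lt_neqAle => /andP[]; rewrite -rk_val_le => le_u _.
move: lt_su; rewrite -lt_val => /rk_mono.
by rewrite rk_s ltnNge le_u.
Qed.

Lemma covers_below_trunc s t : rk (val s) < m -> covers s t -> t != \top%O.
Proof.
move=> lt_s cov_st; apply: contraTneq cov_st => ->.
by rewrite covers_trunc_top ltn_eqF.
Qed.

Lemma covers_lift s (x : P) : rk (val s) < m -> covers (val s) x ->
  exists2 t, covers s t & val t = x.
Proof.
move=> lt_s cov_sx; have le_x: rk x <= m by rewrite (rk_covers _ _ cov_sx).
have x_tr : in_trunc k x by rewrite /in_trunc le_x.
exists (Sub x x_tr : Tr); rewrite ?SubK // covers_val ?SubK //.
by rewrite -rk_val_le SubK.
Qed.

Lemma covers_rk_lt s t : covers s t -> t != \top%O -> rk (val s) < m.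
Proof.
move=> cov_st t_ntop; move: (cov_st); rewrite covers_val //.
by move/rk_covers; move: t_ntop; rewrite -rk_val_le => le_t <-.
Qed.

Lemma covers_ntop s t : covers s t -> s != \top%O.
Proof. by move=> /covers_lt lt_st; rewrite lt_eqF // (lt_le_trans lt_st) ?lex1. Qed.

Lemma path_val s q : last s q != \top%O ->
  path covers s q = path covers (val s) (map val q).
Proof.
elim/last_ind: q => //= q t IHq.
rewrite last_rcons map_rcons !rcons_path last_map => t_ntop.
rewrite -covers_val //; have [cov_t|] := boolP (covers _ t); last by rewrite !andbF.
by rewrite IHq // (covers_ntop cov_t).
Qed.

Lemma path_lift s (c : seq P) :
  path covers (val s) c -> rk (last (val s) c) <= m ->
  exists q, c = map val q.
Proof.
elim/last_ind: c => [|c x IHc]; first by exists [::].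
rewrite rcons_path last_rcons => /andP[path_c cov_x] le_x.
have lt_c : rk (last (val s) c) < m by rewrite -(rk_covers _ _ cov_x).
have [q def_c] := IHc path_c (ltnW lt_c).
have x_tr : in_trunc k x by rewrite /in_trunc le_x.
by exists (rcons q (Sub x x_tr)); rewrite map_rcons SubK def_c.
Qed.

Lemma path_trunc_top s q : s != \top%O -> path covers s q -> last s q = \top%O ->
  exists2 q', q = rcons q' \top%O
    & path covers s q' /\ rk (val (last s q')) = m.
Proof.
case/lastP: q => [/eqP//|q t] s_ntop; rewrite last_rcons rcons_path.
move=> /andP[path_q cov_t] def_t; rewrite def_t in cov_t *.
by exists q => //; split=> //; apply/eqP; rewrite -covers_trunc_top.
Qed.

(** * The labeling of the truncation *)

(** An edge [(s, \top)] stands for the increasing chain of [P] from [s] to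
    [\top], and carries the first label of that chain. *)
Definition trunc_labeling : edge_labeling Tr L := fun s t =>
  if t == \top%O then head (lam (val s) (val t)) (labels_above lam (val s))
  else lam (val s) (val t).

Lemma label_seq_val s q : path covers s q -> last s q != \top%O ->
  label_seq trunc_labeling s q = label_seq lam (val s) (map val q).
Proof.
rewrite /label_seq; elim/last_ind: q => //= q t IHq.
rewrite last_rcons rcons_path map_rcons !pairmap_rcons last_map.
move=> /andP[path_q cov_t] t_ntop.
by rewrite IHq ?(covers_ntop cov_t) // /trunc_labeling (negbTE t_ntop).
Qed.

(** The last label of [cut] is the first label along [c], which is itself
    increasing; so [full] has no descents beyond those of [cut]. *)
Lemma trunc_chain_extension s q (c : seq P) :
  EL_labeling lam -> path covers s q -> rk (val (last s q)) = m ->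
  increasing_chain lam (val (last s q)) \top%O c ->
  let full := label_seq lam (val s) (map val q ++ c) in
  let cut := label_seq trunc_labeling s (rcons q \top%O) in
  (exists l : seq L, full = cut ++ l) /\ sorted <=%O full = sorted <=%O (cut : seq L).
Proof.
move=> EL path_q rk_q inc_c; have last_ntop: last s q != \top%O.
  by rewrite -rk_val_le rk_q.
rewrite /= /label_seq pairmap_rcons pairmap_cat last_map.
have := label_seq_val path_q last_ntop; rewrite /label_seq => ->.
case: c inc_c => [[[_ top_q]]|u c inc_c].
  by move: rk_q ltn_trunc_rank; rewrite [val _]top_q => <-; rewrite ltnn.
have -> : trunc_labeling (last s q) \top%O = lam (val (last s q)) u.
  by rewrite /trunc_labeling eqxx -(increasing_chain_head _ EL inc_c).
rewrite /= -cat_rcons.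
split; first by eexists.
case: inc_c => _ /= sorted_c.
by rewrite cat_rcons sorted_cat_cons sorted_c andbT.
Qed.

(** All elements of such an interval have rank at most [m], so it is an interval
    of [P] with the same labels. *)
Lemma trunc_EL_below s t : EL_labeling lam -> (s <= t)%O -> t != \top%O ->
  exists p, unique (increasing_chain trunc_labeling s t) p /\
    forall q, maximal_chain s t q ->
      (label_seq trunc_labeling s p <= label_seq trunc_labeling s q)%O.
Proof.
move=> EL; rewrite -Order.le_val => le_st t_ntop.
have to_val q : maximal_chain s t q ->
    maximal_chain (val s) (val t) (map val q)
    /\ label_seq trunc_labeling s q = label_seq lam (val s) (map val q).
  case=> path_q last_q; have last_ntop: last s q != \top%O by rewrite last_q.
  by split; [split; rewrite ?last_map ?last_q -?path_val | rewrite label_seq_val].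
have [c [[[[path_c last_c] sorted_c] uniq_c] min_c]] := EL _ _ le_st.
have [|p def_c] := path_lift path_c; first by rewrite last_c rk_val_le.
rewrite {c}def_c in path_c last_c sorted_c uniq_c min_c.
have last_p : last s p = t by apply: val_inj; rewrite -last_map.
have chain_p : maximal_chain s t p by split; rewrite // path_val ?last_p.
have [_ lab_p] := to_val p chain_p.
exists p; split; first split.
- by split; rewrite ?lab_p.
- move=> q [/to_val[chain_q lab_q] sorted_q].
  by apply: (inj_map val_inj); apply: uniq_c; split; rewrite -?lab_q.
- by move=> q /to_val[chain_q lab_q]; rewrite lab_p lab_q; apply: min_c.
Qed.

(** The chain [p] is the increasing chain of [P] from [s] to [\top] cut at rank
    [m].  All maximal chains from [s] have the same length up to rank [m], so
    the comparison of completed chains restricts to the cut ones, and equality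
    of completed chains forces equality of their lower parts. *)
Lemma trunc_EL_top s : EL_labeling lam -> s != \top%O ->
  exists p, unique (increasing_chain trunc_labeling s \top%O) p /\
    forall q, maximal_chain s \top%O q ->
      (label_seq trunc_labeling s p <= label_seq trunc_labeling s q)%O.
Proof.
move=> EL s_ntop; have [c [[inc_c uniq_c] min_c]] := EL _ _ (lex1 (val s)).
have [[path_c last_c] sorted_c] := inc_c.
have le_s: rk (val s) <= m by rewrite rk_val_le.
have [p [c2 [def_c path_p rk_p]]] : exists p c2,
    [/\ c = map val p ++ c2, path covers s p & rk (val (last s p)) = m].
  have path_take: path covers (val s) (take (m - rk (val s)) c).
    by move: path_c; rewrite -{1}(cat_take_drop (m - rk (val s)) c) cat_path => /andP[].
  have rk_take: rk (last (val s) (take (m - rk (val s)) c)) = m.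
    rewrite (rk_path path_take) size_takel ?subnKC //.
    rewrite leq_subLR -(rk_path path_c) last_c.
    exact/ltnW/ltn_trunc_rank.
  have [|p def_p] := path_lift path_take; first by rewrite rk_take.
  exists p, (drop (m - rk (val s)) c); rewrite -def_p cat_take_drop.
  rewrite def_p last_map in path_take rk_take.
  by split; rewrite // path_val // -rk_val_le rk_take.
rewrite {c path_c last_c}def_c in inc_c sorted_c uniq_c min_c.
have := increasing_chain_catr inc_c; rewrite last_map => inc_c2.
have [[l full_p] sorted_p] := trunc_chain_extension EL path_p rk_p inc_c2.
(* Minimality and uniqueness in [P] apply to a chain [rcons q \top] only after
   it is completed above rank [m]. *)
have extend q : path covers s q -> rk (val (last s q)) = m ->
    exists c', [/\ maximal_chain (val s) \top%O (map val q ++ c'),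
      size q = size p,
      exists l' : seq L, label_seq lam (val s) (map val q ++ c')
        = label_seq trunc_labeling s (rcons q \top%O) ++ l'
      & sorted <=%O (label_seq lam (val s) (map val q ++ c') : seq L)
        = sorted <=%O (label_seq trunc_labeling s (rcons q \top%O) : seq L)].
  move=> path_q rk_q; have [c' [[inc_c' _] _]] := EL _ _ (lex1 (val (last s q))).
  have path_vq q' : path covers s q' -> rk (val (last s q')) = m ->
      path covers (val s) (map val q').
    by move=> path_q' rk_q'; rewrite -path_val // -rk_val_le rk_q'.
  have [ext_q sorted_q] := trunc_chain_extension EL path_q rk_q inc_c'.
  exists c'; split=> //.
    case: inc_c' => -[path_c' last_c'] _; split; last by rewrite last_cat last_map.
    by rewrite cat_path path_vq // last_map.
  apply/eqP; rewrite -(eqn_add2l (rk (val s))) -[size q](size_map val).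
  by rewrite -[size p](size_map val) -!rk_path ?path_vq // !last_map rk_q rk_p.
exists (rcons p \top%O); split; first split.
- split; last by rewrite -sorted_p.
  by split; rewrite ?last_rcons // rcons_path path_p covers_trunc_top rk_p /=.
- move=> q [[path_q last_q] sorted_q].
  have [q' def_q [path_q' rk_q']] := path_trunc_top s_ntop path_q last_q.
  have [c' [chain_q' sz_q' _ sorted_q']] := extend q' path_q' rk_q'.
  rewrite {}def_q in sorted_q *; rewrite -sorted_q' in sorted_q.
  have /eqP := uniq_c _ (conj chain_q' sorted_q).
  rewrite eqseq_cat ?size_map ?sz_q' // => /andP[/eqP/(inj_map val_inj)-> _] //.
- move=> q [path_q last_q].
  have [q' -> [path_q' rk_q']] := path_trunc_top s_ntop path_q last_q.
  have [c' [chain_q' sz_q' [l' full_q'] _]] := extend q' path_q' rk_q'.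
  have := min_c _ chain_q'; rewrite full_p full_q'; apply: lexi_prefix.
  by rewrite !size_pairmap !size_rcons sz_q'.
Qed.

Lemma trunc_EL : EL_labeling lam -> EL_labeling trunc_labeling.
Proof.
move=> EL s t le_st; have [->|] := eqVneq t \top%O; last exact: trunc_EL_below.
have [->|] := eqVneq s \top%O; last exact: trunc_EL_top.
have nil_q q : maximal_chain (\top%O : Tr) \top%O q -> q = [::].
  case=> /rk_path rk_q def_q; move: rk_q; rewrite def_q.
  by move/eqP; rewrite -{1}[rk _]addn0 eqn_add2l eq_sym size_eq0 => /eqP.
exists [::]; split; first by split=> // q [/nil_q].
by move=> q /nil_q->.
Qed.

(** * Labels above the elements of the truncation *)

Lemma labels_above_trunc s : rk (val s) < m ->
  labels_above trunc_labeling s = labels_above lam (val s).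
Proof.
move=> lt_s; apply/perm_sort_leP/uniq_perm; rewrite ?undup_uniq // => a.
rewrite -(mem_sort <=%O) -[RHS](mem_sort <=%O).
apply/(labels_aboveP trunc_labeling)/(labels_aboveP lam) => -[t cov_t ->].
  have t_ntop := covers_below_trunc lt_s cov_t.
  by exists (val t); rewrite /trunc_labeling ?(negbTE t_ntop) // -covers_val.
have [t' cov_t' <-] := covers_lift lt_s cov_t; exists t' => //.
by rewrite /trunc_labeling (negbTE (covers_below_trunc lt_s cov_t')).
Qed.

Lemma covers_maxE s t : rk (val s) = m -> covers s t = (t == \top%O).
Proof.
move=> rk_s; have [->|t_ntop] := eqVneq t; first by rewrite covers_trunc_top rk_s eqxx.
by apply/negP => /covers_rk_lt/(_ t_ntop); rewrite rk_s ltnn.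
Qed.

Lemma labels_above_trunc_max s : rk (val s) = m ->
  labels_above trunc_labeling s = [:: trunc_labeling s \top%O].
Proof.
move=> rk_s; apply: (@perm_small_eq _ _ [:: trunc_labeling s \top%O]) => //.
apply: uniq_perm; rewrite ?labels_above_uniq // => a; rewrite inE.
apply/labels_aboveP/eqP => [[t]|->].
  by rewrite covers_maxE // => /eqP->.
by exists \top%O; rewrite ?covers_maxE.
Qed.

Lemma width_trunc s i : rk (val s) < m ->
  width trunc_labeling s i = width lam (val s) i.
Proof.
move=> lt_s; rewrite /width labels_above_trunc //.
rewrite -(card_imset _ (val_inj : injective (val : Tr -> P))).
congr #|pred_of_set _|; apply/setP => x; rewrite inE.
apply/imsetP/andP => [[t]|[cov_x lab_x]].
  rewrite inE => /andP[cov_t lab_t] ->.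
  have t_ntop := covers_below_trunc lt_s cov_t.
  by rewrite -covers_val //; move: lab_t; rewrite /trunc_labeling (negbTE t_ntop).
have [t cov_t def_x] := covers_lift lt_s cov_x; exists t; rewrite // inE cov_t.
by rewrite /trunc_labeling (negbTE (covers_below_trunc lt_s cov_t)) def_x.
Qed.

Lemma width_trunc_max s s' i : rk (val s) = m -> rk (val s') = m ->
  width trunc_labeling s i = width trunc_labeling s' i.
Proof.
move=> rk_s rk_s'; rewrite /width !labels_above_trunc_max //.
congr #|pred_of_set _|; apply/setP => t; rewrite !inE !covers_maxE //.
by case: eqP => //= ->; case: i.-1 => [|[]] //=; rewrite !eqxx.
Qed.

Lemma Ind_trunc s t : covers s t -> t != \top%O ->
  Ind trunc_labeling s t = Ind lam (val s) (val t).
Proof.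
move=> cov_t t_ntop; rewrite /Ind labels_above_trunc ?(covers_rk_lt cov_t) //.
by rewrite /trunc_labeling (negbTE t_ntop).
Qed.

Lemma des_trunc_top s : des trunc_labeling s \top%O = 0.
Proof.
rewrite /des; case def_l: (labels_above _ _) => [//|a l].
have: a \in labels_above trunc_labeling \top%O by rewrite def_l mem_head.
by case/labels_aboveP => t /covers_ntop; rewrite eqxx.
Qed.

(** Above an element of rank [m] only the smallest of the original labels
    remains; it lies below a given label iff any of them does. *)
Lemma des_trunc s t : covers s t -> t != \top%O ->
  des trunc_labeling s t =
    if rk (val t) == m then minn 1 (des lam (val s) (val t))
    else des lam (val s) (val t).
Proof.
move=> cov_t t_ntop; rewrite /des {1 2}/trunc_labeling (negbTE t_ntop).
case: eqP => [rk_t|/eqP rk_t]; last first.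
  by rewrite labels_above_trunc // ltn_neqAle rk_t rk_val_le.
rewrite labels_above_trunc_max //= addn0 /trunc_labeling eqxx.
set x0 := lam _ _; set a := lam _ _.
have lt_t : (val t < \top :> P)%O.
  by rewrite lt_neqAle lex1 andbT -rk_rank rk_t ltn_eqF // ltn_trunc_rank.
have [x cov_x _] := covers_below lt_t.
have [head_t _] := head_labels_above lam x0 cov_x.
have := count_lt_sorted x0 a (labels_above_sorted lam (val t)).
case: (labels_above lam (val t)) head_t => //= b l _.
by case: (_ + _) => [|c] <- //; rewrite (minn_idPl _).
Qed.

(** * Rank-uniformity and monotonicity *)

Lemma rk_trunc_eq s s' : s != \top%O -> rk s = rk s' ->
  s' != \top%O /\ rk (val s) = rk (val s').
Proof.
move=> s_ntop rk_ss'; have s'_ntop: s' != \top%O.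
  by rewrite -rk_rank -rk_ss' rk_rank.
by rewrite -!trunc_rkE.
Qed.

Lemma covers_eq_top s t s' t' : covers s t -> covers s' t' -> rk s = rk s' ->
  (t == \top%O) = (t' == \top%O).
Proof.
move=> /rk_covers rk_t /rk_covers rk_t' rk_ss'.
by rewrite -!rk_rank rk_t rk_t' rk_ss'.
Qed.

Lemma trunc_rank_uniform : rank_uniform lam -> rank_uniform trunc_labeling.
Proof.
case=> EL width_eq des_eq; split; first exact: trunc_EL.
- move=> s s' i rk_ss' i_gt0.
  have [s_top|s_ntop] := eqVneq s \top%O.
    by move/eqP: rk_ss'; rewrite s_top eq_sym rk_rank => /eqP->.
  have [s'_ntop rk_vss'] := rk_trunc_eq s_ntop rk_ss'.
  move: s_ntop; rewrite -rk_val_le leq_eqVlt => /orP[/eqP rk_s|lt_s].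
    by apply: width_trunc_max; rewrite // -rk_vss'.
  by rewrite !width_trunc -?rk_vss' //; apply: width_eq.
move=> s t s' t' cov_t cov_t' rk_ss' Ind_eq.
have top_eq := covers_eq_top cov_t cov_t' rk_ss'.
have [t_top|t_ntop] := eqVneq t \top%O.
  by move: top_eq; rewrite t_top eqxx => /esym/eqP->; rewrite !des_trunc_top.
have t'_ntop : t' != \top%O by rewrite -top_eq.
have [_ rk_vss'] := rk_trunc_eq (covers_ntop cov_t) rk_ss'.
rewrite !Ind_trunc // in Ind_eq; rewrite !des_trunc //.
rewrite !covers_val // in cov_t cov_t'.
by rewrite (rk_covers _ _ cov_t) (rk_covers _ _ cov_t') rk_vss' (des_eq _ _ _ _ cov_t cov_t').
Qed.

(** By uniformity both values of [desr] may be computed at edges above one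
    element [s]; [des_trunc] then reduces the claim to monotonicity in [P]. *)
Lemma trunc_monotonic :
  rank_uniform lam -> monotonic lam -> monotonic trunc_labeling.
Proof.
move=> ru mono r i j _ i_gt0 le_ij le_j.
have ru' := trunc_rank_uniform ru.
have [s rk_s] : exists s : Tr, rk s = r.
  move: le_j; rewrite /nlabelsr; case: pickP => [s /eqP|_]; first by exists s.
  by case: (j) le_ij => //; rewrite leqn0 => /eqP i0; rewrite i0 in i_gt0.
rewrite -{r}rk_s nlabelsr_eq // in le_j *.
have [|t cov_t Ind_t] := @Ind_surj _ _ _ _ trunc_labeling s i.
  by rewrite i_gt0 (leq_trans le_ij).
have [|t' cov_t' Ind_t'] := @Ind_surj _ _ _ _ trunc_labeling s j.
  by rewrite le_j (leq_trans i_gt0).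
rewrite -Ind_t -Ind_t' !desr_eq //.
have top_eq := covers_eq_top cov_t cov_t' erefl.
have [->|t_ntop] := eqVneq t \top%O; first by rewrite des_trunc_top.
have t'_ntop : t' != \top%O by rewrite -top_eq.
have lt_s := covers_rk_lt cov_t t_ntop.
have le_des: des lam (val s) (val t) <= des lam (val s) (val t').
  rewrite -!desr_eq // -?covers_val // -!Ind_trunc // Ind_t Ind_t'.
  apply: mono => //; first exact: ltn_trans lt_s ltn_trunc_rank.
  by rewrite nlabelsr_eq // -labels_above_trunc.
have rk_eq: rk (val t) = rk (val t').
  by move: cov_t cov_t'; rewrite !covers_val // => /rk_covers-> /rk_covers->.
rewrite !des_trunc // rk_eq; case: eqP => // _.
by rewrite leq_min geq_minl (leq_trans (geq_minr _ _)).
Qed.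

End Truncation.

Theorem proposition7p1 (d dL : Order.disp_t) (P : gradedPosetType d)
    (L : orderType dL) (lam : edge_labeling P L) (n : nat) :
  rank P = n -> rank_uniform lam ->
  forall k : nat, 1 <= k <= n - 1 ->
    exists (dM : Order.disp_t) (M : orderType dM)
      (lamk : edge_labeling (trunc P k) M),
      rank_uniform lamk /\ (monotonic lam -> monotonic lamk).
Proof.
move=> rank_n ru k /andP[k_gt0 le_k].
have rank_gt0 : 0 < rank P by rewrite rank_n; case: (n) le_k => //; case: (k) k_gt0.
exists dL, L, (@trunc_labeling _ _ _ _ lam k).
by split; [exact: trunc_rank_uniform | exact: trunc_monotonic].
Qed.
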